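(* Let $\mathcal{G}=(V,\mathcal{E})$ be a sparsity pattern with $\alpha$-nodes $V_\alpha=\{\alpha_1,\ldots,\alpha_n\}$ such that: (i) there is only one single $\beta$-node, denoted $\beta$; (ii) the node $\alpha_1\in V_\alpha$ has a self-loop, and $(\beta,\alpha_1)$ is an edge of $\mathcal{G}$; (iii) the subgraph $\mathcal{G}_\alpha$ of $\mathcal{G}$ induced by $V_\alpha$ contains a directed spanning tree with root $\alpha_1$; (iv) there is an edge from $\alpha_1$ to any other $\alpha$-node. Then $\mathcal{G}$ is structurally averaged controllable.
   Context: Let $n,m$ be positive integers and $\Sigma=[0,1]$. Sparsity patterns. A sparsity pattern is a directed graph $\mathcal{G}=(V,\mathcal{E})$ (self-loops allowed) with node set $V=\{\alpha_1,\ldots,\alpha_n,\beta_1,\ldots,\beta_m\}$ such that no $\beta$-node has an incoming edge. $\mathbb{V}(\mathcal{G})$ denotes the vector space of all pairs $(A,B)\in \mathrm{C}^0(\Sigma,\mathbb{R}^{n\times n}\times\mathbb{R}^{n\times m})$ compliant with $\mathcal{G}$, meaning: the $(j,i)$ entry of $A$ is the zero function whenever $(\alpha_i,\alpha_j)\notin\mathcal{E}$, and the $(j,i)$ entry of $B$ is the zero function whenever $(\beta_i,\alpha_j)\notin\mathcal{E}$. Averaged controllability. Given continuous $A:\Sigma\to\mathbb{R}^{n\times n}$ and $B:\Sigma\to\mathbb{R}^{n\times m}$, consider the linear ensemble system $$\frac{\partial}{\partial t}x(t,\sigma)=A(\sigma)x(t,\sigma)+B(\sigma)u(t),\qquad \sigma\in\Sigma,\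 t\ge 0, \tag{E}$$ with $x(t,\sigma)\in\mathbb{R}^n$ and a control input $u(t)\in\mathbb{R}^m$ that does not depend on $\sigma$. System (E) is averaged controllable if for any $x_0\in\mathbb{R}^n$ and any initial profile $x(0,\cdot)\in \mathrm{C}^0(\Sigma,\mathbb{R}^n)$ with $\int_0^1 x(0,\sigma)\,\mathrm{d}\sigma=x_0$, any target $x^*\in\mathbb{R}^n$, and any time $T>0$, there is $u\in \mathrm{L}^1([0,T];\mathbb{R}^m)$ such that $\int_0^1 x(T,\sigma)\,\mathrm{d}\sigma=x^*$. $\mathcal{G}$ is structurally averaged controllable if there is a pair $(A,B)\in\mathbb{V}(\mathcal{G})$ such that (E) is averaged controllable. *)

(* Defs.v *)
From HB Require Import structures.
From mathcomp Require Import all_boot all_order all_algebra.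
From mathcomp Require Import all_classical all_reals all_analysis.
Set Implicit Arguments.
Unset Strict Implicit.
Unset Printing Implicit Defensive.
Import Order.TTheory GRing.Theory Num.Theory.
Import numFieldNormedType.Exports.

Local Open Scope classical_set_scope.
Local Open Scope ring_scope.

(* Nodes are numbered from 0: alpha_1 is [alpha ord0]. *)
Definition node (n m : nat) : Type := ('I_n + 'I_m)%type.
Definition alpha {n m : nat} (i : 'I_n) : node n m := inl i.
Definition beta {n m : nat} (k : 'I_m) : node n m := inr k.

Record sparsity_pattern (n m : nat) := SparsityPattern {
  edge : node n m -> node n m -> bool;
  beta_no_incoming : forall (v : node n m) (k : 'I_m), ~~ edge v (beta k)
}.

Definition alpha_subgraph (n m : nat) (G : sparsity_pattern n m) : rel 'I_n :=
  fun i j => edge G (alpha i) (alpha j).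

(* A directed tree spanning the whole vertex type: the root has no parent,
   every other vertex has exactly one parent and is reachable from the root. *)
Definition directed_tree (V : finType) (root : V) (t : rel V) : Prop :=
  [/\ forall v, ~~ t v root,
      forall v, v != root -> #|[pred u | t u v]| = 1%N
    & forall v, connect t root v].

Definition has_spanning_tree (V : finType) (e : rel V) (root : V) : Prop :=
  exists t : rel V, subrel t e /\ directed_tree root t.

Section ensemble.
Context {R : realType}.

(* Functions on Sigma are total functions of which only the restriction to
   Sigma is ever used. *)
Definition Sigma : set R := `[0, 1].

Definition compliant (n m : nat) (G : sparsity_pattern n m)
    (A : R -> 'M[R]_n) (B : R -> 'M[R]_(n, m)) : Prop :=
  [/\ {within Sigma, continuous A}, {within Sigma, continuous B},
      forall i j : 'I_n, ~~ edge G (alpha i) (alpha j) ->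
        forall s, Sigma s -> A s j i = 0
    & forall (i : 'I_m) (j : 'I_n), ~~ edge G (beta i) (alpha j) ->
        forall s, Sigma s -> B s j i = 0].

Definition average (n : nat) (f : R -> 'cV[R]_n) : 'cV[R]_n :=
  \col_i \int[lebesgue_measure]_(s in Sigma) f s i 0.

Definition L1 (n : nat) (T : R) (f : R -> 'cV[R]_n) : Prop :=
  forall i, lebesgue_measure.-integrable `[0, T] (fun t => (f t i 0)%:E).

(* [x t s] is the state x(t, sigma). As the control is only integrable in time,
   x(., sigma) is a solution in the sense of Caratheodory: absolutely
   continuous on [0, T] and satisfying the equation almost everywhere, i.e.
   the indefinite integral of an integrable right-hand side. *)
Definition ensemble_solution (n m : nat) (A : R -> 'M[R]_n)
    (B : R -> 'M[R]_(n, m)) (T : R) (u : R -> 'cV[R]_m)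
    (xi : R -> 'cV[R]_n) (x : R -> R -> 'cV[R]_n) : Prop :=
  (forall t, `[0, T]%classic t -> {within Sigma, continuous (x t)}) /\
  forall s, Sigma s ->
    let rhs := fun tau : R => A s *m x tau s + B s *m u tau in
    L1 T rhs /\
    forall t, `[0, T]%classic t -> forall i,
      x t s i 0 = xi s i 0 + \int[lebesgue_measure]_(tau in `[0, t]) rhs tau i 0.

Definition averaged_controllable (n m : nat) (A : R -> 'M[R]_n)
    (B : R -> 'M[R]_(n, m)) : Prop :=
  forall (x0 : 'cV[R]_n) (xi : R -> 'cV[R]_n),
    {within Sigma, continuous xi} -> average xi = x0 ->
  forall (xstar : 'cV[R]_n) (T : R), 0 < T ->
  exists u : R -> 'cV[R]_m, L1 T u /\
  exists x : R -> R -> 'cV[R]_n,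
    ensemble_solution A B T u xi x /\ average (x T) = xstar.

End ensemble.

Definition structurally_averaged_controllable (R : realType) (n m : nat)
    (G : sparsity_pattern n m) : Prop :=
  exists (A : R -> 'M[R]_n) (B : R -> 'M[R]_(n, m)),
    compliant G A B /\ averaged_controllable A B.

(* Main.v *)
From HB Require Import structures.
Require Import Defs.
From mathcomp Require Import all_boot all_order all_algebra.
From mathcomp Require Import all_classical all_reals all_analysis.
From mathcomp Require Import ring.

(** The nonzero entries are placed only on the star centred at [alpha_1].  With
    [r = 1 + sigma], ranging over [[1, 2]], take
      x_0' = r x_0 + u,    x_i' = r^(i+1) x_0   for i > 0,
    that is, [A] has first column [(r^(i+1))_i] and zeros elsewhere, and [B] is
    the first basis vector.

    Let [U] be a primitive of the control with [U(0) = 0].  All the coordinates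
    are then driven by one scalar [z(t, sigma)]:
      x_i = xi_i + r^i z + delta_(i0) U,    z' = r x_0,    z(0) = 0,
    and [z] is the sum of a free part [(e^(rt) - 1) xi_0] and of [r y], where
    [y' = r y + U] and [y(0) = 0].

    Controls with polynomial [U] suffice, and for these [y] is explicit, since
    [P = - sum_i r^(-i-1) U^(i)] satisfies [P' = r P + U] as soon as [r] is
    nonzero; this is why [r] is [1 + sigma] and not [sigma].  Choose a
    polynomial [g], positive inside [[0, T]] and vanishing to order [n + 1] at
    both ends (there are [n + 1] coordinates), and put
    [U = sum_k c_k g^(k)], with [k <= n].  Because of the vanishing, forcing by
    [g^(k)] gives at time [T] the response [r^k h(r)], where [h(r)], the
    response to [g], is positive ([forced_response_derivn],
    [forced_response_gt0]); moreover [U(T) = 0].  Hence the average of [x_i(T)] is a term independent of [c] plus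
      sum_k c_k (int_0^1 r^(i+k) r h(r) dsigma).
    The matrix of this linear system is the Gram matrix of the monomials
    [1, r, .., r^n] for a positive weight, so it is invertible ([gram_unitmx])
    and some [c] reaches the prescribed average. *)

Set Implicit Arguments.
Unset Strict Implicit.
Unset Printing Implicit Defensive.
Import Order.TTheory GRing.Theory Num.Theory.
Import numFieldNormedType.Exports.
Local Open Scope classical_set_scope.
Local Open Scope ring_scope.

(** * Scalar equations with polynomial forcing *)

Section polynomial_forcing.
Context {R : realType}.
Implicit Types (s t T a : R) (p g U : {poly R}) (L : nat).

(** The polynomial solution of [y' = s y + U], obtained by expanding
    [(d/dt - s)^-1] in powers of [d/dt]; the series stops at [L] when
    [U^`(L) = 0].  A fixed [L], rather than [size U], makes the solution
    linear in [U]. *)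
Definition poly_response L s U : {poly R} :=
  - \sum_(i < L) s ^- i.+1 *: U^`(i).

Lemma poly_response_is_linear L s : linear (poly_response L s).
Proof.
move=> a U V; rewrite /poly_response scalerN -opprD scaler_sumr -big_split /=.
congr (- _); apply: eq_bigr => i _.
by rewrite derivnD derivnZ scalerDr !scalerA mulrC.
Qed.

HB.instance Definition _ L s := GRing.isLinear.Build R {poly R} {poly R} _
  (poly_response L s) (poly_response_is_linear L s).

Lemma derivn_comm p i j : p^`(i)^`(j) = p^`(j)^`(i).
Proof. by rewrite /derivn -!iterD addnC. Qed.

Lemma poly_response_derivn L s U k :
  poly_response L s U^`(k) = (poly_response L s U)^`(k).
Proof.
rewrite /poly_response derivnN [in RHS]raddf_sum; congr (- _).
by apply: eq_bigr => i _; rewrite /= derivnZ derivn_comm.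
Qed.

Lemma deriv_poly_response L s U : s != 0 -> U^`(L) = 0 ->
  (poly_response L s U)^`() = s *: poly_response L s U + U.
Proof.
move=> s0 UL0; rewrite -derivn1 -poly_response_derivn derivn1.
(* The remainder of the telescoping sum is the term in [U^`(L)]. *)
suff telescope : \sum_(i < L) s ^- i.+1 *: U^`(i.+1) + U =
    s *: (\sum_(i < L) s ^- i.+1 *: U^`(i)) + s ^- L *: U^`(L).
  rewrite /poly_response scalerN.
  under eq_bigr do rewrite -derivSn.
  move: telescope; rewrite UL0 scaler0 addr0 => <-.
  by rewrite opprD -addrA addNr addr0.
elim: L {UL0} => [|L IH].
  by rewrite !big_ord0 scaler0 expr0 invr1 scale1r derivn0.
rewrite !big_ord_recr /= addrAC IH scalerDr; congr (_ + _ + _).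
by rewrite scalerA exprS invfM mulrA divff// mul1r.
Qed.

(** The solution of [y' = s y + U] with [y(0) = 0], that is, the convolution
    of [U] with [exp (s t)]. *)
Definition forced_response L s U t : R :=
  (poly_response L s U).[t] - expR (s * t) * (poly_response L s U).[0].

Lemma forced_response0 L s U : forced_response L s U 0 = 0.
Proof. by rewrite /forced_response mulr0 expR0 mul1r subrr. Qed.

Lemma is_derive_expRM s t :
  is_derive t 1 (fun t => expR (s * t)) (s * expR (s * t)).
Proof.
have -> : (fun t => expR (s * t)) = expR \o (s *: (@id R)) by [].
apply: trigger_derive; rewrite /= /GRing.scale /= mulr1.
by rewrite mulrC.
Qed.

Lemma is_derive_forced_response L s U t : s != 0 -> U^`(L) = 0 ->
  is_derive t 1 (forced_response L s U) (s * forced_response L s U t + U.[t]).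
Proof.
move=> s0 UL0; set P := poly_response L s U; set a := P.[0].
rewrite [forced_response L s U t]/forced_response -/P -/a.
have -> : forced_response L s U = horner P - (fun t => expR (s * t)) * cst a.
  by [].
have ? := is_derive_expRM s t.
apply: trigger_derive.
rewrite deriv_poly_response// -/P hornerD hornerZ.
rewrite /GRing.scale /= /cst.
ring.
Qed.

Lemma derivn_root_dvdp p a N i : ('X - a%:P) ^+ N %| p -> (i < N)%N ->
  p^`(i).[a] = 0.
Proof.
elim: i p N => [|i IH] p [|N] // /Pdiv.Field.dvdpP[q ->] iN.
  by rewrite derivn0 !hornerE subrr exprS mul0r mulr0.
rewrite derivSn; apply: (IH _ N) => //.
rewrite derivM deriv_exp derivXsubC mul1r dvdp_add //.
  by rewrite exprS mulrA dvdp_mulIr.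
by rewrite mulrnAr -mulrnAl dvdp_mulIr.
Qed.

(** Each derivation multiplies the response by [s] and adds a derivative of [g],
    which vanishes at [a]. *)
Lemma poly_response_derivn_root L s g a k : s != 0 -> g^`(L) = 0 ->
  (forall i, (i < k)%N -> g^`(i).[a] = 0) ->
  (poly_response L s g^`(k)).[a] = s ^+ k * (poly_response L s g).[a].
Proof.
move=> s0 gL0; elim: k => [|k IH] ga; first by rewrite expr0 mul1r derivn0.
rewrite poly_response_derivn derivnS -poly_response_derivn.
rewrite deriv_poly_response//; last by rewrite derivn_comm gL0 linear0.
rewrite hornerD hornerZ ga// addr0 IH ?exprS ?mulrA// => i ik.
by apply: ga; exact: ltnW.
Qed.

(** Integration by parts in the convolution with [exp (s t)]: the boundary terms
    vanish, and each derivative of [g] contributes a factor [s].  This is what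
    makes powers of [s] available at time [T]. *)
Lemma forced_response_derivn L s g T k : s != 0 -> g^`(L) = 0 ->
  (forall i, (i < k)%N -> g^`(i).[0] = 0 /\ g^`(i).[T] = 0) ->
  forced_response L s g^`(k) T = s ^+ k * forced_response L s g T.
Proof.
move=> s0 gL0 g0T; rewrite /forced_response !poly_response_derivn_root//.
- ring.
- by move=> i /g0T[].
- by move=> i /g0T[].
Qed.

Lemma forced_response_gt0 L s g T : s != 0 -> g^`(L) = 0 -> 0 < T ->
  (forall t, 0 < t < T -> 0 < g.[t]) -> 0 < forced_response L s g T.
Proof.
move=> s0 gL0 T0 g_gt0.
(* The integrating factor: [F' = exp (- s t) g], which is positive. *)
pose F t := expR (- s * t) * forced_response L s g t.
have dF t : is_derive t 1 F (expR (- s * t) * g.[t]).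
  have ? := is_derive_expRM (- s) t.
  have ? := is_derive_forced_response t s0 gL0.
  have -> : F = (fun t => expR (- s * t)) * forced_response L s g by [].
  apply: trigger_derive; rewrite /= /GRing.scale /=. ring.
have [|c + eqF] := MVT T0 (fun t _ => dF t).
  apply: continuous_subspaceT => t.
  exact/differentiable_continuous/derivable1_diffP.
rewrite in_itv /= => cT.
have : 0 < F T.
  have -> : F T = F T - F 0 by rewrite {3}/F forced_response0 mulr0 subr0.
  by rewrite eqF !mulr_gt0 ?expR_gt0 ?g_gt0 ?subr0.
by rewrite pmulr_rgt0 ?expR_gt0.
Qed.

Lemma continuous_exprV s k : s != 0 -> {for s, continuous (fun s => s ^- k)}.
Proof.
move=> s0; have sk0 : s ^+ k != 0 by rewrite expf_neq0.
apply: (@cvgV _ _ (nbhs s) _ (fun s => s ^+ k) _ sk0).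
exact: exprn_continuous.
Qed.

Lemma continuous_forced_response L U T s : s != 0 ->
  {for s, continuous (fun s => forced_response L s U T)}.
Proof.
move=> s0; have cP t : {for s, continuous (fun s => (poly_response L s U).[t])}.
  rewrite /poly_response.
  have -> : (fun s => (- \sum_(i < L) s ^- i.+1 *: U^`(i)).[t]) =
      (fun s => - \sum_(i < L) s ^- i.+1 * U^`(i).[t]).
    apply/funext => r; rewrite hornerN horner_sum.
    by under eq_bigr do rewrite hornerZ.
  apply: cvgN; apply: cvg_big => [|i _]; first exact: add_continuous.
  apply: cvgM; last exact: cvg_cst.
  exact: (@continuous_exprV s i.+1 s0).
apply: cvgB; first exact: cP.
apply: cvgM; last exact: cP.
apply: continuous_comp; last exact: continuous_expR.
by apply: cvgM; [exact: cvg_id | exact: cvg_cst].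
Qed.

End polynomial_forcing.

(** * Averages over the parameter and integration in time *)

Section averages.
Context {R : realType}.
Local Notation mu := (@lebesgue_measure R).
Local Notation Sigma := (@Sigma R).
Local Notation avg f := (\int[mu]_(s in Sigma) f s).
Implicit Types (f g : R -> R).

Lemma integrable_Sigma f :
  {within Sigma, continuous f} -> mu.-integrable Sigma (EFin \o f).
Proof.
by move=> cf; apply: continuous_compact_integrable; [exact: segment_compact|].
Qed.

Lemma measurable_Sigma : measurable Sigma.
Proof. exact: measurable_itv. Qed.

Lemma within_continuous_cst (T U : topologicalType) (D : set T) (a : U) :
  {within D, continuous (fun _ : T => a)}.
Proof. by move=> x; exact: cvg_cst. Qed.

Lemma within_continuousM (T : topologicalType) (D : set T) (f g : T -> R) :
  {within D, continuous f} -> {within D, continuous g} ->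
  {within D, continuous (f * g)}.
Proof. by move=> cf cg x; apply: cvgM; [exact: cf|exact: cg]. Qed.

Lemma within_continuous_sum (T : topologicalType) (V : normedModType R)
  (D : set T) (I : Type) (r : seq I) (f : I -> T -> V) :
  (forall i, {within D, continuous (f i)}) ->
  {within D, continuous (fun s => \sum_(i <- r) f i s)}.
Proof.
by move=> cf x; apply: cvg_big => [|i _]; [exact: add_continuous|exact: cf].
Qed.

Lemma averageD f g :
  {within Sigma, continuous f} -> {within Sigma, continuous g} ->
  avg (f + g) = avg f + avg g.
Proof.
move=> cf cg; rewrite RintegralD//; first exact: measurable_Sigma.
  exact: integrable_Sigma.
exact: integrable_Sigma.
Qed.

Lemma averageZ (a : R) f : {within Sigma, continuous f} ->
  avg (fun s => a * f s) = a * avg f.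
Proof.
move=> cf; rewrite RintegralZl//; first exact: measurable_Sigma.
exact: integrable_Sigma.
Qed.

Lemma average_sum (I : Type) (r : seq I) (f : I -> R -> R) :
  (forall i, {within Sigma, continuous (f i)}) ->
  avg (fun s => \sum_(i <- r) f i s) = \sum_(i <- r) avg (f i).
Proof.
move=> cf; elim: r => [|i r IH].
  under eq_Rintegral do rewrite big_nil.
  by rewrite Rintegral_cst ?mul0r ?big_nil//; exact: measurable_Sigma.
under eq_Rintegral do rewrite big_cons.
by rewrite big_cons -IH -averageD//; exact: within_continuous_sum.
Qed.

(** [f] vanishes almost everywhere; were it nonzero at some point, it would be
    nonzero on a ball, which has positive measure. *)
Lemma average_ge0_eq0 f : {within Sigma, continuous f} ->
  (forall s, Sigma s -> 0 <= f s) -> avg f = 0 ->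
  forall s, 0 < s < 1 -> f s = 0.
Proof.
move=> cf f0 avgf s s01; apply/eqP; apply: contraPT avgf => fs0.
have If := integrable_Sigma cf.
have /integrableP[mf _] := If.
move=> avgf.
have /ae_eq_integral_abs : (\int[mu]_(s in Sigma) `|(EFin \o f) s| = 0)%E.
  rewrite -[RHS]/(0%:E) -avgf /Rintegral fineK; last first.
    by apply: integrable_fin_num => //; exact: measurable_Sigma.
  by apply: eq_integral => x /[!inE] /f0 fx0; rewrite gee0_abs.
case=> //; first exact: measurable_Sigma.
move=> N [mN N0 subN].
have cfs : {for s, continuous f}.
  by apply: (within_continuous_continuous _ cf) => //; rewrite in_itv.
have s_itv : s \in `]0, 1[ by rewrite in_itv.
have : \forall x \near s, N x.
  have near_neq0 : \forall x \near s, f x != 0 by exact: cvgr_neq0 cfs fs0.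
  apply: filterS2 near_neq0 (near_in_itvoo s_itv) => x fx_neq0 x01.
  apply: subN => /= fx0.
  have Sx : Sigma x.
    by move: x01; rewrite /Defs.Sigma /= !in_itv /= => /andP[/ltW -> /ltW ->].
  by have [/eqP] := fx0 Sx; rewrite (negPf fx_neq0).
move=> /nbhs_ballP[e /= e0 eN].
have : (mu (ball s e) <= mu N)%E.
  apply: le_measure => //.
    by apply/mem_set; exact: measurable_realfun.measurable_ball.
  by apply/mem_set.
by rewrite N0 lebesgue_measure_ball ?(ltW e0)// lee_fin leNgt pmulrn_lgt0 ?e0.
Qed.

Lemma integral_derive f (F : R -> R) T :
  (forall t : R, is_derive t 1 F (f t)) -> continuous f ->
  mu.-integrable `[0, T] (EFin \o f) /\
  forall t, 0 <= t -> \int[mu]_(tau in `[0, t]) f tau = F t - F 0.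
Proof.
move=> dF cf; split.
  apply: continuous_compact_integrable; first exact: segment_compact.
  exact: continuous_subspaceT.
move=> t; rewrite le_eqVlt => /predU1P[<-|t0].
  by rewrite set_itv1 Rintegral_set1 subrr.
have cF : continuous F.
  move=> x; apply/differentiable_continuous/derivable1_diffP.
  by have [] := dF x.
rewrite /Rintegral (@continuous_FTC2 _ f F)//.
- exact: continuous_subspaceT.
- split.
  + by move=> x _; have [] := dF x.
  + exact/cvg_at_right_filter/cF.
  + exact/cvg_at_left_filter/cF.
- by move=> x _; rewrite derive1E; have [] := dF x.
Qed.

Lemma continuous_within_mx (T : topologicalType) (D : set T) m n
    (M : T -> 'M[R]_(m, n)) :
  (forall i j, {within D, continuous (fun s => M s i j)}) ->
  {within D, continuous M}.
Proof.
move=> cM x A [P nP sPA].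
have : \forall y \near (nbhs (x : subspace D)), forall i j, P i j (M y i j).
  apply: filter_forall => i; apply: filter_forall => j.
  exact: (cM i j x _ (nP i j)).
by apply: filterS => y Py; exact: sPA.
Qed.

End averages.

(** * Gram matrices of monomials *)

Section gram.
Context {R : realType}.
Local Notation mu := (@lebesgue_measure R).
Local Notation Sigma := (@Sigma R).
Local Notation avg f := (\int[mu]_(s in Sigma) f s).

Lemma poly_eq0_itv (p : {poly R}) :
  (forall s : R, 0 < s < 1 -> p.[1 + s] = 0) -> p = 0.
Proof.
move=> p0; apply/eqP; apply: contraT => /max_poly_roots.
move=> /(_ [seq 1 + i.+2%:R^-1 | i <- iota 0 (size p)]).
rewrite size_map size_iota ltnn; apply.
  apply/allP => _ /mapP[i _ ->]; apply/rootP/p0.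
  by rewrite invr_gt0 ltr0n /= invf_lt1 ?ltr1n ?ltr0n.
rewrite map_inj_uniq ?iota_uniq// => i j /addrI /invr_inj /eqP.
by rewrite eqr_nat !eqSS => /eqP.
Qed.

Lemma within_continuous_horner1D (p : {poly R}) (D : set R) :
  {within D, continuous (fun s => p.[1 + s])}.
Proof.
apply: continuous_subspaceT => s.
apply: continuous_comp; last exact: continuous_horner.
by apply: cvgD; [exact: cvg_cst | exact: cvg_id].
Qed.

Lemma within_continuous_nodeX k :
  {within Sigma, continuous (fun s => (1 + s) ^+ k)}.
Proof.
have -> : (fun s : R => (1 + s) ^+ k) = (fun s => ('X^k).[1 + s]).
  by apply/funext => s; rewrite hornerXn.
exact: within_continuous_horner1D.
Qed.

(** A vector [v] in the kernel, read as the coefficients of a polynomial [p],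
    makes the average of [p ^+ 2 * w] zero; so [p] vanishes on an interval. *)
Lemma gram_unitmx N (w : R -> R) :
  {within Sigma, continuous w} -> (forall s, Sigma s -> 0 < w s) ->
  \matrix_(j < N, k < N) avg (fun s => (1 + s) ^+ (j + k) * w s) \in unitmx.
Proof.
move=> cw w0; set M := \matrix_(j, k) _.
rewrite unitmxE unitfE; apply/det0P => -[v v0 vM].
pose p := rVpoly v.
have pE x : p.[x] = \sum_(j < N) v 0 j * x ^+ j.
  rewrite (@horner_coef_wide _ N) ?size_poly//.
  by apply: eq_bigr => j _; rewrite coef_rVpoly_ord.
have cX k : {within Sigma, continuous (fun s => (1 + s) ^+ k * w s)}.
  apply: (@within_continuousM R R Sigma (fun s => (1 + s) ^+ k)) => //.
  exact: within_continuous_nodeX.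
have quad0 : avg (fun s => p.[1 + s] ^+ 2 * w s) = 0.
  transitivity ((v *m M *m v^T) 0 0); last by rewrite vM mul0mx mxE.
  transitivity (avg (fun s => \sum_(k < N) \sum_(j < N)
      v 0 k * v 0 j * ((1 + s) ^+ (j + k) * w s))).
    apply: eq_Rintegral => s _; rewrite expr2 pE mulr_suml mulr_suml.
    apply: eq_bigr => k _; rewrite mulr_sumr mulr_suml.
    by apply: eq_bigr => j _; rewrite exprD; ring.
  have cvX k j : {within Sigma, continuous (fun s =>
      v 0 k * v 0 j * ((1 + s) ^+ (j + k) * w s))}.
    apply: (@within_continuousM R R Sigma (cst (v 0 k * v 0 j))) => //.
    exact: within_continuous_cst.
  rewrite average_sum; last by move=> k; exact: within_continuous_sum.
  rewrite mxE; apply: eq_bigr => k _; rewrite average_sum//.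
  rewrite !mxE mulr_suml; apply: eq_bigr => j _; rewrite averageZ// !mxE.
  ring.
have p0 : p = 0.
  apply: poly_eq0_itv => s s01.
  have /eqP : p.[1 + s] ^+ 2 * w s = 0.
    apply: (average_ge0_eq0 _ _ quad0 s01) => [|r /w0 wr].
      apply: (@within_continuousM R R Sigma (fun s => p.[1 + s] ^+ 2)) => //.
      have -> : (fun s => p.[1 + s] ^+ 2) = (fun s => (p ^+ 2).[1 + s]).
        by apply/funext => r; rewrite horner_exp.
      exact: within_continuous_horner1D.
    by rewrite mulr_ge0 ?sqr_ge0// ltW.
  have /w0/lt0r_neq0/negPf ws : Sigma s.
    by move: s01; rewrite /Defs.Sigma /= in_itv /= => /andP[/ltW -> /ltW ->].
  by rewrite mulf_eq0 ws orbF expf_eq0 => /eqP.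
by move: v0; rewrite -(rVpolyK v) -/p p0 linear0 eqxx.
Qed.

End gram.

(** * The star ensemble *)

Section star_ensemble.
Context {R : realType} (n : nat).
Local Notation mu := (@lebesgue_measure R).
Local Notation Sigma := (@Sigma R).
Local Notation avg f := (\int[mu]_(s in Sigma) f s).
Implicit Types (s t T : R) (U : {poly R}) (xi : R -> 'cV[R]_n.+1).

Definition star_A s : 'M[R]_n.+1 :=
  \matrix_(i, j) ((1 + s) ^+ i.+1 *+ (j == ord0)).

Definition star_B s : 'M[R]_(n.+1, 1) := delta_mx ord0 ord0.

(** The time integral of [(1 + s) * x_0], by which every state coordinate is
    driven; in closed form, free part plus forced part. *)
Definition star_excess L U xi t s : R :=
  (expR ((1 + s) * t) - 1) * xi s ord0 0
  + (1 + s) * forced_response L (1 + s) U t.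

Definition star_state L U xi t s : 'cV[R]_n.+1 :=
  \col_i (xi s i 0 + (1 + s) ^+ i * star_excess L U xi t s
          + U.[t] *+ (i == ord0)).

Lemma Sigma_node_neq0 s : Sigma s -> 1 + s != 0.
Proof.
by rewrite /Defs.Sigma /= in_itv /= => /andP[s0 _]; rewrite gt_eqF ?ltr_wpDr.
Qed.

Lemma within_continuous_node (f : R -> R) :
  (forall r, r != 0 -> {for r, continuous f}) ->
  {within Sigma, continuous (fun s => f (1 + s))}.
Proof.
move=> cf; apply: continuous_in_subspaceT => s.
rewrite inE => /Sigma_node_neq0 s0.
apply: (@continuous_comp _ _ _ (fun s => 1 + s) f); last exact: cf.
by apply: cvgD; [exact: cvg_cst | exact: cvg_id].
Qed.

Lemma within_continuous_add1 : {within Sigma, continuous (fun s => 1 + s)}.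
Proof. by apply: (within_continuous_node (f := id)) => r _; exact: cvg_id. Qed.

Lemma within_continuous_forced L U t :
  {within Sigma, continuous (fun s => forced_response L (1 + s) U t)}.
Proof.
apply: (within_continuous_node (f := fun r => forced_response L r U t)) => r r0.
exact: continuous_forced_response.
Qed.

Lemma within_continuous_free t :
  {within Sigma, continuous (fun s => expR ((1 + s) * t) - 1)}.
Proof.
apply: (within_continuous_node (f := fun r => expR (r * t) - 1)) => r _.
apply: cvgB; last exact: cvg_cst.
apply: continuous_comp; last exact: continuous_expR.
by apply: cvgM; [exact: cvg_id | exact: cvg_cst].
Qed.

Lemma within_continuous_entry xi i : {within Sigma, continuous xi} ->
  {within Sigma, continuous (fun s => xi s i 0)}.
Proof.
move=> cxi x; apply: (@cvg_comp _ _ _ xi (fun M : 'cV[R]_n.+1 => M i 0)).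
  exact: cxi.
exact: coord_continuous.
Qed.

Lemma within_continuous_excess L U xi t : {within Sigma, continuous xi} ->
  {within Sigma, continuous (star_excess L U xi t)}.
Proof.
move=> cxi; apply: within_continuousD; apply: within_continuousM.
- exact: within_continuous_free.
- exact: within_continuous_entry.
- exact: within_continuous_add1.
- exact: within_continuous_forced.
Qed.

Lemma within_continuous_state L U xi t : {within Sigma, continuous xi} ->
  {within Sigma, continuous (star_state L U xi t)}.
Proof.
move=> cxi; apply: continuous_within_mx => i j.
have -> : (fun s => star_state L U xi t s i j) =
    (fun s => xi s i 0) + (fun s => (1 + s) ^+ i) * star_excess L U xi t
    + cst (U.[t] *+ (i == ord0)).
  by apply/funext => s; rewrite mxE.
apply: within_continuousD; last exact: within_continuous_cst.
apply: within_continuousD; first exact: within_continuous_entry.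
apply: within_continuousM; first exact: within_continuous_nodeX.
exact: within_continuous_excess.
Qed.

Lemma is_derive_affine (f g : R -> R) (a b c df dg t : R) :
  is_derive t 1 f df -> is_derive t 1 g dg ->
  is_derive t 1 (fun t => c + a * f t + b * g t) (a * df + b * dg).
Proof.
move=> Df Dg.
have -> : (fun t => c + a * f t + b * g t) = cst c + a \*: f + b \*: g by [].
rewrite -[a * df]add0r; exact: is_deriveD.
Qed.

Lemma is_derive_excess L U xi s t : Sigma s -> U^`(L) = 0 ->
  is_derive t 1 (star_excess L U xi ^~ s)
    ((1 + s) * star_state L U xi t s ord0 0).
Proof.
move=> /Sigma_node_neq0; set r := 1 + s => r0 UL0.
rewrite mxE eqxx expr0 mul1r mulr1n /star_excess -/r; set x0 := xi s ord0 0.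
rewrite (_ : (fun t => _) =
  (fun t => - x0 + x0 * expR (r * t) + r * forced_response L r U t)).
  have := is_derive_affine x0 r (- x0) (is_derive_expRM r t)
    (is_derive_forced_response t r0 UL0).
  by move/is_derive_eq; apply; ring.
by apply/funext => t'; ring.
Qed.

Lemma star_AE s (x : 'cV[R]_n.+1) (v : 'cV[R]_1) i :
  (star_A s *m x + star_B s *m v) i 0 =
  (1 + s) ^+ i.+1 * x ord0 0 + v 0 0 *+ (i == ord0).
Proof.
rewrite !mxE big_ord_recl big_ord1 big1 => [|j _]; last first.
  by rewrite mxE mulr0n mul0r.
by rewrite !mxE eqxx mulr1n addr0 andbT mulr_natl.
Qed.

Lemma is_derive_state L U xi s t i : Sigma s -> U^`(L) = 0 ->
  is_derive t 1 (fun t => star_state L U xi t s i 0)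
    ((star_A s *m star_state L U xi t s + star_B s *m const_mx U^`().[t]) i 0).
Proof.
move=> Ss UL0; rewrite star_AE [in X in _ + X]mxE exprSr -mulrA -mulr_natl.
have dU : is_derive t 1 (horner U) U^`().[t] by exact: is_derive_poly.
rewrite (_ : (fun t => _) = (fun t => xi s i 0
    + (1 + s) ^+ i * star_excess L U xi t s + (i == ord0)%:R * U.[t])).
  exact: (is_derive_affine _ _ _ (is_derive_excess xi t Ss UL0) dU).
by apply/funext => t'; rewrite mxE mulr_natl.
Qed.

Lemma star_solution L U xi T : U^`(L) = 0 -> U.[0] = 0 ->
  {within Sigma, continuous xi} ->
  ensemble_solution star_A star_B T (fun t => const_mx U^`().[t]) xi
    (star_state L U xi).
Proof.
move=> UL0 U0 cxi; split; first by move=> t _; exact: within_continuous_state.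
move=> s Ss rhs.
have ds i t : is_derive t 1 (fun t => star_state L U xi t s i 0) (rhs t i 0).
  exact: is_derive_state.
have cd (f df : R -> R) :
    (forall t : R, is_derive t 1 f (df t)) -> continuous f.
  move=> Df t; apply/differentiable_continuous/derivable1_diffP.
  by have [] := Df t.
have crhs i : continuous (fun t => rhs t i 0).
  have -> : (fun t => rhs t i 0) =
    cst ((1 + s) ^+ i.+1) * (fun t => star_state L U xi t s ord0 0)
    + cst (i == ord0)%:R * horner U^`().
    apply/funext => t; rewrite /rhs star_AE [in X in _ + X]mxE.
    by rewrite -[_ *+ (i == _)]mulr_natl.
  move=> t; apply: cvgD; apply: cvgM; first exact: cvg_cst.
  - exact: (cd _ _ (ds ord0)).
  - exact: cvg_cst.
  - exact: continuous_horner.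
have FTC i := integral_derive T (ds i) (crhs i).
split; first by move=> i; have [] := FTC i.
move=> t; rewrite /= in_itv /= => /andP[t0 _] i.
have [_ ->//] := FTC i.
have -> : star_state L U xi 0 s i 0 = xi s i 0.
  rewrite mxE /star_excess forced_response0 U0 !mulr0 expR0 subrr mul0r.
  by rewrite addr0 mulr0 mul0rn !addr0.
by rewrite addrC subrK.
Qed.

(** The generator of the controls: vanishing to order [n.+1] at both ends lets
    it be differentiated up to [n] times without boundary terms. *)
Lemma bump_exists T : 0 < T -> exists g : {poly R},
  (forall i, (i < n.+1)%N -> g^`(i).[0] = 0 /\ g^`(i).[T] = 0) /\
  forall t, 0 < t < T -> 0 < g.[t].
Proof.
move=> T0; exists ('X ^+ n.+1 * (T%:P - 'X) ^+ n.+1).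
split=> [i iN|t /andP[t0 tT]].
  split; apply: derivn_root_dvdp iN.
    by rewrite subr0 dvdp_mulIl.
  have -> : T%:P - 'X = (-1) * ('X - T%:P) by rewrite mulN1r opprB.
  by rewrite exprMn mulrA dvdp_mulIr.
by rewrite !hornerE mulr_gt0 ?exprn_gt0// subr_gt0.
Qed.

(** Linear algebra in the coefficients [c] of the control: the average reached
    at time [T] is [free + M *m c], with [M] an invertible Gram matrix. *)
Lemma star_averaged_controllable : averaged_controllable star_A star_B.
Proof.
move=> _ xi cxi _ xstar T T0.
have [g [g0T g_gt0]] := bump_exists T0.
pose L := size g.
have gL0 : g^`(L) = 0 by exact: derivn_poly0.
pose h s := forced_response L (1 + s) g T.
pose w s := (1 + s) * h s.
have cw : {within Sigma, continuous w}.
  apply: within_continuousM; first exact: within_continuous_add1.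
  exact: within_continuous_forced.
have w_gt0 s : Sigma s -> 0 < w s.
  move=> Ss; rewrite mulr_gt0 ?forced_response_gt0 ?Sigma_node_neq0//.
  move: Ss; rewrite /Defs.Sigma /= in_itv /= => /andP[s0 _].
  by rewrite ltr_wpDr.
have := @gram_unitmx _ n.+1 w cw w_gt0; set M := \matrix_(j, k) _ => uM.
(* The average reached at time [T] when the control is zero. *)
pose free : 'cV[R]_n.+1 := \col_i (avg (fun s => xi s i 0) +
  avg (fun s => (1 + s) ^+ i * ((expR ((1 + s) * T) - 1) * xi s ord0 0))).
pose c := invmx M *m (xstar - free).
pose U := \sum_(k < n.+1) c k 0 *: g^`(k).
have UL0 : U^`(L) = 0.
  rewrite raddf_sum /= big1// => k _.
  by rewrite derivnZ derivn_comm gL0 !linear0.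
have Uat a : (a = 0 \/ a = T) -> U.[a] = 0.
  move=> aE; rewrite horner_sum big1// => k _; rewrite hornerZ.
  have [gk0 gkT] := g0T k (ltn_ord k).
  by case: aE => ->; rewrite ?gk0 ?gkT mulr0.
exists (fun t => const_mx U^`().[t]); split.
  move=> i; rewrite (_ : (fun t => _) = EFin \o horner U^`()); last first.
    by apply/funext => t /=; rewrite mxE.
  apply: continuous_compact_integrable; first exact: segment_compact.
  by apply: continuous_subspaceT; exact: continuous_horner.
exists (star_state L U xi); split.
  by apply: star_solution => //; apply: Uat; left.
have y_T s : Sigma s ->
    forced_response L (1 + s) U T =
    \sum_(k < n.+1) c k 0 * ((1 + s) ^+ k * h s).
  move=> Ss; transitivity
    (\sum_(k < n.+1) c k 0 * forced_response L (1 + s) g^`(k) T).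
    rewrite /forced_response raddf_sum /= !horner_sum mulr_sumr -sumrB.
    by apply: eq_bigr => k _; rewrite linearZ /= !hornerZ; ring.
  apply: eq_bigr => k _.
  rewrite forced_response_derivn ?Sigma_node_neq0// => i ik.
  by apply: g0T; exact: ltn_trans ik (ltn_ord k).
apply/colP => i; rewrite mxE.
suff -> : avg (fun s => star_state L U xi T s i 0) = (free + M *m c) i 0.
  by rewrite /c mulKVmx// addrC subrK.
have cfree : {within Sigma, continuous (fun s =>
    (1 + s) ^+ i * ((expR ((1 + s) * T) - 1) * xi s ord0 0))}.
  apply: within_continuousM; first exact: within_continuous_nodeX.
  apply: within_continuousM; first exact: within_continuous_free.
  exact: within_continuous_entry.
have cM k : {within Sigma, continuous (fun s => (1 + s) ^+ (i + k) * w s)}.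
  by apply: within_continuousM => //; exact: within_continuous_nodeX.
have cterm (k : 'I_n.+1) : {within Sigma, continuous (fun s =>
    c k 0 * ((1 + s) ^+ (i + k) * w s))}.
  apply: (@within_continuousM R R Sigma (cst (c k 0))) => //.
  exact: within_continuous_cst.
have centry := @within_continuous_entry xi i cxi.
transitivity (avg ((fun s => xi s i 0)
  + (fun s => (1 + s) ^+ i * ((expR ((1 + s) * T) - 1) * xi s ord0 0))
  + (fun s => \sum_(k < n.+1) c k 0 * ((1 + s) ^+ (i + k) * w s)))).
  apply: eq_Rintegral => s /[!inE] Ss.
  rewrite mxE (Uat T); last by right.
  rewrite mul0rn addr0 /star_excess y_T// mulrDr addrA; congr (_ + _).
  rewrite !mulr_sumr; apply: eq_bigr => k _; rewrite exprD /w; ring.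
rewrite averageD; last by exact: within_continuous_sum.
  rewrite averageD// average_sum// mxE [free i 0]mxE [(M *m c) i 0]mxE.
  congr (_ + _).
  by apply: eq_bigr => k _; rewrite averageZ// [M i k]mxE mulrC.
exact: within_continuousD.
Qed.

End star_ensemble.

(** * Sparsity patterns containing a star *)

Theorem theorem2p9 (R : realType) (n : nat) (G : sparsity_pattern n.+1 1)
  (alpha1_loop : edge G (alpha ord0) (alpha ord0))
  (beta_alpha1 : edge G (beta ord0) (alpha ord0))
  (spanning : has_spanning_tree (alpha_subgraph G) ord0)
  (alpha1_out : forall j : 'I_n.+1, j != ord0 ->
     edge G (alpha ord0) (alpha j)) :
  structurally_averaged_controllable R G.
Proof.
exists (@star_A R n), (@star_B R n).
split; last exact: star_averaged_controllable.
split.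
- apply: continuous_within_mx => i j.
  have -> : (fun s : R => star_A n s i j) =
      (fun s => (1 + s) ^+ i.+1) * cst (j == ord0)%:R.
    by apply/funext => s; rewrite mxE -mulr_natr.
  apply: within_continuousM; first exact: within_continuous_nodeX.
  exact: within_continuous_cst.
- exact: within_continuous_cst.
- move=> i j; have [->|i0 _ s _] := eqVneq i ord0; last first.
    by rewrite mxE (negPf i0).
  by have [->|/alpha1_out ->] := eqVneq j ord0; rewrite ?alpha1_loop.
- move=> i j; rewrite (ord1 i); have [->|j0 _ s _] := eqVneq j ord0.
    by rewrite beta_alpha1.
  by rewrite mxE (negPf j0).
Qed.
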